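(* Let $H=\mathbb{F}_{q^2}(x,y)$, $y^q+y=x^{q+1}$, be the Hermitian function field, and for an integer $a$ let $\mathcal{H}_a=C_{\mathcal{L}}^H(D',aQ_\infty)$ be the Hermitian code. If $q\mid a$, then $\mathcal{H}_a$ is a conorm code, namely the conorm code with respect to $H/\mathbb{F}_{q^2}(x)$ of a rational AG-code over $\mathbb{F}_{q^2}(x)$.
   Context: Hermitian function field: $H=\mathbb{F}_{q^2}(x,y)$ with $y^q+y=x^{q+1}$, an extension of degree $q$ of the rational function field $F=\mathbb{F}_{q^2}(x)$. It has $q^3+1$ rational places: for each pair $(\alpha,\beta)\in\mathbb{F}_{q^2}^2$ with $\beta^q+\beta=\alpha^{q+1}$ a unique rational place $P_{\alpha,\beta}$ with $x(P_{\alpha,\beta})=\alpha$, $y(P_{\alpha,\beta})=\beta$, and the common pole $Q_\infty$ of $x$ and $y$, lying above the pole $P_\infty$ of $x$ in $F$. The divisor $D'$ is $D'=\sum_{\beta^q+\beta=\alpha^{q+1}}P_{\alpha,\beta}$, the sum of all rational places of $H$ different from $Q_\infty$. AG-codes: for a function field $E$ with full constant field $K$ finite, $D=P_1+\cdots+P_n$ a sum of $n$ distinct rational (degree one) places of $E$ and $G$ a divisor of $E$ with support disjoint from that of $D$, $C_{\mathcal{L}}^E(D,G)=\{(z(P_1),\ldots,z(P_n)):z\in\mathcal{L}(G)\}\subseteq K^n$, where $z(P_i)$ is the residue class of $z$ modulo $P_i$ and $\mathcal{L}(G)=\{z\in E^*:(z)\ge -G\}\cup\{0\}$. A rational AG-code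 is an AG-code over a rational function field. Conorm of divisors: $\mathrm{Con}_{F'/F}(P)=\sum_{P'|P}e(P'|P)P'$ with $e(P'|P)$ the ramification index, extended linearly to all divisors. Conorm code: let $F'/F$ be a finite extension of function fields of degree $m$ and let $m_P$ be the number of places of $F'$ above $P$. The conorm code of $\mathcal{C}=C_{\mathcal{L}}^F(D,G)$ is defined if for every $P$ in the support of $D$ one has $e(P'|P)=m/m_P$ for all places $P'$ of $F'$ above $P$ (all these places are then rational). It is $\mathrm{Con}_{F'/F}(\mathcal{C})=C_{\mathcal{L}}^{F'}(D',G')$, where $D'$ is the sum of all places of $F'$ lying above the places in the support of $D$ (each with coefficient 1) and $G'=\mathrm{Con}_{F'/F}(G)$. *)

(* Defs.v *)
From HB Require Import structures.
From mathcomp Require Import all_boot all_order all_algebra all_field.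
From mathcomp Require Import boolp classical_sets functions cardinality fsbigop.
From mathcomp Require Import finmap freeg.

Set Implicit Arguments.
Unset Strict Implicit.
Unset Printing Implicit Defensive.

Import GRing.Theory.
Local Open Scope ring_scope.
Local Open Scope classical_set_scope.

(* [E] is a field extension of [K] through [iota]; no finiteness is assumed,  *)
(* since a function field is transcendental over its constants.               *)
Section Places.
Context (K E : fieldType) (iota : {rmorphism K -> E}).

Record valuation_ring (O : set E) : Prop := {
  vr1 : O 1;
  vrB : forall z w, O z -> O w -> O (z - w);
  vrM : forall z w, O z -> O w -> O (z * w);
  vr_const : range iota `<` O;
  vr_proper : O `<` setT;
  vr_total : forall z, O z \/ O z^-1
}.

(* A place is the maximal ideal of a valuation ring.  The ring and its ideal  *)
(* determine each other; the record stores the ring, and [maxideal] is the    *)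
(* ideal of its non-units.                                                    *)
Record place := Place {
  place_ring :> set E;
  place_ringP : valuation_ring place_ring
}.

HB.instance Definition _ := gen_eqMixin place.
HB.instance Definition _ := gen_choiceMixin place.

Definition ring_unit (P : place) : set E :=
  [set z | [/\ z != 0, place_ring P z & place_ring P z^-1]].

Definition maxideal (P : place) : set E := place_ring P `\` ring_unit P.

Definition uniformizer (P : place) (t : E) : Prop :=
  maxideal P = [set t * w | w in place_ring P].

(* The discrete valuation: v_P(z) = n when z = t ^ n * u, with t a prime      *)
(* element and u a unit.  The true value at 0 is +oo; here [valuation P 0]    *)
(* is the junk value 0, so 0 is always treated apart.                         *)
Definition valuation (P : place) (z : E) : int :=
  xget 0 [set n : int | exists t u,
    [/\ uniformizer P t, ring_unit P u & z = t ^ n * u]].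

Definition pole (P : place) (z : E) : Prop := z != 0 /\ valuation P z < 0.

(* z(P) = c *)
Definition has_value (P : place) (z : E) (c : K) : Prop :=
  maxideal P (z - iota c).

(* Degree one: the constants fill the residue field O_P / P. *)
Definition rational_place (P : place) : Prop :=
  forall z, place_ring P z -> exists c, has_value P z c.

Definition value (P : place) (z : E) : K := xget 0 [set c | has_value P z c].

Definition divisor := {freeg place / int}.

Definition riemann_roch_space (G : divisor) : set E :=
  [set z | z = 0 \/ forall P, - coeff P G <= valuation P z].

(* The divisor D = P_1 + ... + P_n is given with the ordering of its places   *)
(* that fixes the coordinates of K^n.                                         *)
Definition ag_data n (D : n.-tuple place) (G : divisor) : Prop :=
  [/\ uniq D,
      forall P, P \in D -> rational_place P
    & forall P, P \in D -> coeff P G = 0].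

Definition ag_code n (D : n.-tuple place) (G : divisor) : set 'rV[K]_n :=
  [set \row_(i < n) value (tnth D i) z | z in riemann_roch_space G].

End Places.

Section Conorm.
Context (K F : fieldType) (iota : {rmorphism K -> F}) (L : fieldExtType F).

Definition ext_const : {rmorphism K -> L} := in_alg L \o iota.

Local Notation placeF := (place iota).
Local Notation placeL := (place ext_const).

Definition lies_above (P' : placeL) (P : placeF) : Prop :=
  forall z : F, maxideal P z -> maxideal P' z%:A.

Definition places_above (P : placeF) : set placeL :=
  [set P' | lies_above P' P].

Definition ramification_index (P' : placeL) (P : placeF) : nat :=
  xget 0%N [set e | (0 < e)%N /\
    forall z : F, z != 0 -> valuation P' z%:A = e%:Z * valuation P z].

(* [\sum_(_ \in _)] is a genuine sum because [places_above P] is finite. *)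
Definition conorm (G : divisor iota) : divisor ext_const :=
  fglift (fun P => \sum_(P' \in places_above P)
                     << (ramification_index P' P)%:Z *g P' >>) G.

Definition num_places_above (P : placeF) : nat :=
  #|` fset_set (places_above P)|.

Definition conorm_code_defined n (D : n.-tuple placeF) : Prop :=
  forall P P', P \in D -> lies_above P' P ->
    (ramification_index P' P)%:R =
      (\dim {:L})%:R / (num_places_above P)%:R :> rat.

(* [C'] is the conorm code of C_L(D, G), its coordinates being indexed along  *)
(* the enumeration [D'] of the places above those of [D].                     *)
Definition is_conorm_code n (D : n.-tuple placeF) (G : divisor iota)
    n' (D' : n'.-tuple placeL) (C' : set 'rV[K]_n') : Prop :=
  [/\ conorm_code_defined D,
      uniq D',
      forall P', P' \in D' <-> exists2 P, P \in D & lies_above P' P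
    & C' = ag_code D' (conorm G)].

End Conorm.

Notation ratfun K := {fraction {poly K}}.

Section Hermitian.
Context (K : fieldType).

Definition ratfun_const : {rmorphism K -> ratfun K} :=
  @tofrac {poly K} \o polyC.

Definition ratfun_x : ratfun K := tofrac ('X : {poly K}).

Context (q : nat) (H : fieldExtType (ratfun K)).

Definition herm_x : H := ratfun_x%:A.

(* H = K(x, y) with y ^ q + y = x ^ (q + 1) *)
Definition hermitian_field (y : H) : Prop :=
  <<1; y>>%VS = {:H}%VS /\ y ^+ q + y = herm_x ^+ q.+1.

Local Notation placeH := (place (ext_const ratfun_const H)).

Definition common_pole (y : H) (Q : placeH) : Prop :=
  pole Q herm_x /\ pole Q y.

Definition affine_place (y : H) (a b : K) (P : placeH) : Prop :=
  [/\ rational_place P, has_value P herm_x a & has_value P y b].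

(* D' is the sum of the P_(a, b), with b ^ q + b = a ^ (q + 1), in some order *)
Definition hermitian_support (y : H) n (D' : n.-tuple placeH) : Prop :=
  uniq D' /\
  forall P, P \in D' <->
    exists a b, b ^+ q + b = a ^+ q.+1 /\ affine_place y a b P.

End Hermitian.

(* Main.v *)
From HB Require Import structures.
Require Import Defs.
From mathcomp Require Import all_boot all_order all_algebra all_field.
From mathcomp Require Import boolp classical_sets functions cardinality fsbigop.
From mathcomp Require Import finmap freeg.
From mathcomp Require Import ring zify.
(** Write F = K(x) and a = b q.  The pole of x in F is totally ramified in H:
    Qinf is the only place above it, with ramification index q.  Hence the
    conorm of b Pinf is a Qinf, and G := b Pinf is the divisor of the rational
    code, while D lists the q^2 zeros of the functions x - c, c in K.  What has
    to be shown is that each of these zeros splits completely: it has q places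
    above it in H, all unramified and rational, namely the P_(c, d) with
    d^q + d = c^(q+1).

    Places above infinity.  The function x/y is a local parameter at every pole
    of x: from y^q + y = x^(q+1) one gets (x/y)^q x = (x/y)^(q+1) y
    = 1 + y^-(q-1), so x and y have orders -q and -(q+1).  Every element of H is
    a polynomial of degree less than q in y over F, its nonzero terms have
    orders that are distinct modulo q, and so a single term dominates
    ([leading_reduced_inf]).  The dominating order and coefficient do not depend
    on the place; therefore the pole of x is unique ([place_inf_unique]) and the
    ramification index is q.  A sum with a dominating term is also nonzero, so
    1, y, ..., y^(q-1) are free over F and [H : F] = q ([dim_herm]).

    Places above x = a.  With t = x - a and v = y - b - a^q t the equation
    becomes v^q + v = t^(q+1), by additivity of the q-th power and a^(q^2) = a.
    This curve has the involution (t, v) -> (t/v, 1/v), which exchanges the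
    point t = v = 0 with the pole.  So there are endomorphisms of H over K that
    carry the analysis at infinity to P_(a, b): [affine_to_inf] pulls Qinf back
    to a place P_(a, b), which shows that it exists, and [inf_to_affine]
    transports expansions at infinity to expansions in powers of t, which shows
    that P_(a, b) is unique, rational, and has t as a uniformizer.  As t lies in
    F, this place is unramified.

    The equation b^q + b = a^(q+1) has exactly q solutions b in K by a count:
    the map b -> b^q + b sends the q^2 elements of K to the at most q fixed
    points of the q-th power map, with fibres of at most q elements, so that
    every fibre over a fixed point has q elements ([card_trace_fiber]).  Hence
    the polynomial Y^q + Y - a^(q+1) splits over K, and at a place above x = a
    some factor y - b vanishes ([value_y_exists]). *)

Set Implicit Arguments.
Unset Strict Implicit.
Unset Printing Implicit Defensive.
Import Order.TTheory GRing.Theory Num.Theory.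
Local Open Scope ring_scope.

(** * Valuation rings and residue values *)
Section PlaceTheory.
Context (K E : fieldType) (iota : {rmorphism K -> E}).
Implicit Types (P : place iota) (z w x : E) (c : K).

Lemma place1 P : place_ring P 1. Proof. exact: vr1 (place_ringP P). Qed.

Lemma placeB P z w : place_ring P z -> place_ring P w -> place_ring P (z - w).
Proof. exact: vrB (place_ringP P) z w. Qed.

Lemma placeM P z w : place_ring P z -> place_ring P w -> place_ring P (z * w).
Proof. exact: vrM (place_ringP P) z w. Qed.

Lemma place_const P c : place_ring P (iota c).
Proof. by have [sub _] := vr_const (place_ringP P); apply: sub; exists c. Qed.

Lemma place0 P : place_ring P 0.
Proof. by rewrite -(rmorph0 iota); apply: place_const. Qed.

Lemma placeD P z w : place_ring P z -> place_ring P w -> place_ring P (z + w).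
Proof.
move=> Pz Pw; rewrite -[w]opprK; apply: placeB => //.
by rewrite -sub0r; apply: placeB => //; apply: place0.
Qed.

Lemma placeX P z n : place_ring P z -> place_ring P (z ^+ n).
Proof.
by move=> Pz; elim: n => [|n IH]; rewrite ?exprS; [apply: place1|apply: placeM].
Qed.

Lemma maxidealP P z : maxideal P z <-> place_ring P z /\ (z = 0 \/ ~ place_ring P z^-1).
Proof.
rewrite /maxideal /ring_unit /=; split=> -[Pz nu]; split=> //.
  by have [->|z0] := eqVneq z 0; [left | right => Pzi; apply: nu].
by case: nu => [-> [/eqP]//|nP [_ _]].
Qed.

Lemma maxideal_place P z : maxideal P z -> place_ring P z.
Proof. by case/maxidealP. Qed.

Lemma maxideal0 P : maxideal P 0.
Proof. by apply/maxidealP; split; [apply: place0|left]. Qed.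

Lemma maxideal1 P : ~ maxideal P 1.
Proof.
case/maxidealP=> _ [/eqP|]; first by rewrite oner_eq0.
by rewrite invr1; apply; apply: place1.
Qed.

Lemma maxidealMr P z w : maxideal P z -> place_ring P w -> maxideal P (z * w).
Proof.
move=> /maxidealP[Pz nz] Pw; apply/maxidealP; split; first exact: placeM.
case: nz => [->|nz]; first by left; rewrite mul0r.
have [->|w0] := eqVneq w 0; first by left; rewrite mulr0.
right=> Pzw; apply: nz; have ->: z^-1 = w * (z * w)^-1.
  by rewrite invfM mulrCA divff ?mulr1.
exact: placeM.
Qed.

Lemma maxidealMl P z w : place_ring P z -> maxideal P w -> maxideal P (z * w).
Proof. by rewrite mulrC => Pz /maxidealMr; apply. Qed.

(** One of z/w and w/z is integral, so one of the two elements divides the sum. *)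
Lemma maxidealD P z w : maxideal P z -> maxideal P w -> maxideal P (z + w).
Proof.
wlog Pzw: z w / place_ring P (z / w) => [hw mz mw|mz mw].
  case: (vr_total (place_ringP P) (z / w)); first by move=> /hw; apply.
  by rewrite invf_div addrC => /hw; apply.
have [->|w0] := eqVneq w 0; first by rewrite addr0.
have ->: z + w = w * (z / w + 1) by rewrite mulrDr mulr1 mulrC divfK.
by apply: maxidealMr => //; apply: placeD => //; apply: place1.
Qed.

Lemma maxidealN P z : maxideal P z -> maxideal P (- z).
Proof.
move=> mz; rewrite -mulrN1; apply: maxidealMr => //.
by rewrite -(rmorphN1 iota); apply: place_const.
Qed.

Lemma maxidealB P z w : maxideal P z -> maxideal P w -> maxideal P (z - w).
Proof. by move=> mz /maxidealN; apply: maxidealD. Qed.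

Lemma maxidealV P z : ~ place_ring P z -> maxideal P z^-1.
Proof.
move=> nPz; apply/maxidealP; split; last by right; rewrite invrK.
by case: (vr_total (place_ringP P) z).
Qed.

Lemma maxidealVN P z : z != 0 -> maxideal P z -> ~ place_ring P z^-1.
Proof. by move=> z0 /maxidealP[_ []// /eqP]; rewrite (negPf z0). Qed.

Lemma maxideal_prime P z w : place_ring P z -> place_ring P w ->
  maxideal P (z * w) -> maxideal P z \/ maxideal P w.
Proof.
move=> Pz Pw mzw; have [[]|nz] := pselect (maxideal P z); first by left.
right; have Pzi: place_ring P z^-1.
  by apply: contrapT => nPz; apply: nz; apply/maxidealP; split=> //; right.
have [z0|z0] := eqVneq z 0; first by case: nz; rewrite z0; apply: maxideal0.
by rewrite -[w](mulKf z0); apply: maxidealMl.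
Qed.

Lemma maxidealX P z n : (0 < n)%N -> maxideal P z -> maxideal P (z ^+ n).
Proof.
case: n => // n _ mz; rewrite exprS.
by apply: maxidealMr => //; apply/placeX/maxideal_place.
Qed.

Lemma has_value_place P z c : has_value P z c -> place_ring P z.
Proof.
move=> /maxideal_place Pzc; rewrite -[z](subrK (iota c)).
by apply: placeD => //; apply: place_const.
Qed.

Lemma has_valueC P c : has_value P (iota c) c.
Proof. by rewrite /has_value subrr; apply: maxideal0. Qed.

Lemma has_value1 P : has_value P 1 1.
Proof. by rewrite -{1}(rmorph1 iota); apply: has_valueC. Qed.

Lemma has_value0 P z : has_value P z 0 <-> maxideal P z.
Proof. by rewrite /has_value rmorph0 subr0. Qed.

Lemma has_valueD P z w c d :
  has_value P z c -> has_value P w d -> has_value P (z + w) (c + d).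
Proof.
by rewrite /has_value rmorphD opprD addrACA; apply: maxidealD.
Qed.

Lemma has_valueM P z w c d :
  has_value P z c -> has_value P w d -> has_value P (z * w) (c * d).
Proof.
move=> vz vw; rewrite /has_value rmorphM.
have ->: z * w - iota c * iota d = (z - iota c) * w + iota c * (w - iota d).
  by ring.
apply: maxidealD; first by apply: maxidealMr => //; apply: has_value_place vw.
by apply: maxidealMl => //; apply: place_const.
Qed.

Lemma has_valueX P z c n : has_value P z c -> has_value P (z ^+ n) (c ^+ n).
Proof.
move=> vz; elim: n => [|n IH]; first exact: has_value1.
by rewrite !exprS; apply: has_valueM.
Qed.

Lemma maxideal_const P c : maxideal P (iota c) -> c = 0.
Proof.
move=> mc; apply/eqP/negP=> /negP c0; apply: (maxideal1 (P := P)).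
have <-: iota c * iota c^-1 = 1 by rewrite -rmorphM divff ?rmorph1.
by apply: maxidealMr => //; apply: place_const.
Qed.

Lemma has_value_uniq P z c d : has_value P z c -> has_value P z d -> c = d.
Proof.
move=> vc vd; apply/eqP; rewrite -subr_eq0; apply/eqP/(maxideal_const (P := P)).
have ->: iota (c - d) = (z - iota d) - (z - iota c) by rewrite rmorphB; ring.
exact: maxidealB.
Qed.

Lemma has_value_neq0 P z c : c != 0 -> has_value P z c -> z != 0.
Proof.
move=> c0 vz; apply: contra_neq c0 => z0; apply: has_value_uniq vz _.
by rewrite z0; apply/has_value0/maxideal0.
Qed.

Lemma has_valueV P z c : c != 0 -> has_value P z c -> has_value P z^-1 c^-1.
Proof.
move=> c0 vz; have z0 := has_value_neq0 c0 vz.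
have ic0: iota c != 0 by rewrite fmorph_eq0.
have Pzi: place_ring P z^-1.
  apply: contrapT => /maxidealV; rewrite invrK => mz; apply/negP: c0.
  by rewrite (has_value_uniq vz ((has_value0 _ _).2 mz)) eqxx.
rewrite /has_value fmorphV.
have ->: z^-1 - (iota c)^-1 = (z - iota c) * (- (z^-1 * (iota c)^-1)).
  by field; apply/andP.
apply: maxidealMr => //; rewrite -mulNr; apply: placeM.
  by rewrite -sub0r; apply: placeB => //; apply: place0.
by rewrite -fmorphV; apply: place_const.
Qed.

End PlaceTheory.

(** * Leading terms with respect to a local parameter *)
Section Expansion.
Context (K E : fieldType) (iota : {rmorphism K -> E}).
Implicit Types (P : place iota) (p z w x : E) (c : K) (n : int).

(** The expansion of z in powers of p starts with the term c p^n.  Since the order n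
    and the coefficient c are parameters of the relation, it can be stated that
    they are the same for all places of a family; uniqueness of places is
    deduced from this. *)
Definition leading P p z n c := c != 0 /\ has_value P (z * p ^ (- n)) c.

Lemma leading_neq0 P p z n c : leading P p z n c -> z != 0.
Proof. by case=> c0 /(has_value_neq0 c0); rewrite mulf_eq0 => /norP[]. Qed.

Lemma leading_const P p c : c != 0 -> leading P p (iota c) 0 c.
Proof. by split=> //; rewrite oppr0 expr0z mulr1; apply: has_valueC. Qed.

Lemma leading_value P p z c : c != 0 -> has_value P z c -> leading P p z 0 c.
Proof. by split=> //; rewrite oppr0 expr0z mulr1. Qed.

Lemma leading_self P p : p != 0 -> leading P p p 1 1.
Proof.
by split; rewrite ?oner_eq0 // exprN1 divff //; apply: has_value1.
Qed.

Lemma leadingM P p z w n m c d : p != 0 ->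
  leading P p z n c -> leading P p w m d -> leading P p (z * w) (n + m) (c * d).
Proof.
move=> p0 [c0 vz] [d0 vw]; split; first by rewrite mulf_neq0.
by rewrite opprD expfzDr // mulrACA; apply: has_valueM.
Qed.

Lemma leadingV P p z n c : p != 0 ->
  leading P p z n c -> leading P p z^-1 (- n) c^-1.
Proof.
move=> p0 [c0 vz]; split; first by rewrite invr_neq0.
have ->: z^-1 * p ^ (- - n) = (z * p ^ (- n))^-1 by rewrite invfM invr_expz.
exact: has_valueV.
Qed.

Lemma leadingX P p z n c k : p != 0 ->
  leading P p z n c -> leading P p (z ^+ k) (n *+ k) (c ^+ k).
Proof.
move=> p0 lz; elim: k => [|k IH].
  by rewrite mulr0n !expr0; apply: leading_value (oner_neq0 _) (has_value1 P).
by rewrite !exprS mulrS; apply: leadingM.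
Qed.

Lemma leadingXz P p z n c (k : int) : p != 0 ->
  leading P p z n c -> leading P p (z ^ k) (n * k) (c ^ k).
Proof.
move=> p0 lz; case: k => k; rewrite ?NegzE ?mulrN; last first.
  rewrite -!exprnN; apply: leadingV => //.
  by have := leadingX k.+1 p0 lz; rewrite -mulr_natr natz.
by have := leadingX k p0 lz; rewrite -mulr_natr natz.
Qed.

(** The ultrametric principle: the term of smaller order dominates. *)
Lemma leadingD P p z w n m c d : p != 0 -> maxideal P p -> n < m ->
  leading P p z n c -> leading P p w m d -> leading P p (z + w) n c.
Proof.
move=> p0 mp ltnm [c0 vz] [d0 vw]; split=> //; rewrite mulrDl -[c]addr0.
apply: has_valueD => //; apply/has_value0.
have [k ->]: exists k : nat, n = m - k.+1%:Z.
  by exists (`|m - n|.-1)%N; lia.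
rewrite opprB expfzDr // mulrCA; apply: maxidealMr; first exact: maxidealX.
exact: has_value_place vw.
Qed.

Lemma leading_place P p z n c : p != 0 -> maxideal P p ->
  leading P p z n c -> (place_ring P z <-> 0 <= n).
Proof.
move=> p0 mp [c0 vz].
have [n0|n0] := leP 0 n; split=> // Pz.
  have ->: z = z * p ^ (- n) * p ^ n by rewrite -mulrA -expfzDr // addNr expr0z mulr1.
  apply: placeM (has_value_place vz) _; case: (n) n0 => // k _.
  exact/placeX/maxideal_place.
have mz: maxideal P (z * p ^ (- n)).
  apply: maxidealMl => //; case: (n) n0 => // k _.
  by rewrite NegzE opprK; apply: maxidealX.
by move/has_value0/has_value_uniq: mz => /(_ _ vz) c00; rewrite -c00 eqxx in c0.
Qed.

Lemma leading_maxideal P p z n c : p != 0 -> maxideal P p ->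
  leading P p z n c -> (maxideal P z <-> 0 < n).
Proof.
move=> p0 mp lz; have z0 := leading_neq0 lz.
have h1 := leading_place p0 mp lz.
have h2 := leading_place p0 mp (leadingV p0 lz).
split=> [mz|n0].
  rewrite ltNge; apply/negP => n0; apply: (maxidealVN z0 mz).
  by apply/h2; rewrite oppr_ge0.
apply/maxidealP; split; first by apply/h1/ltW.
by right=> /h2; rewrite oppr_ge0 leNgt n0.
Qed.

(** Existence of leading terms for all nonzero elements is the working form of
    discreteness of the valuation with residue field K; it yields at once a
    uniformizer and the rationality of the place. *)
Definition local_parameter P p :=
  [/\ p != 0, maxideal P p & forall z, z != 0 -> exists n c, leading P p z n c].

Lemma local_parameter_uniformizer P p : local_parameter P p -> uniformizer P p.
Proof.
move=> [p0 mp lead]; apply/seteqP; split=> z /=; last first.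
  by move=> [w Pw <-]; apply: maxidealMr.
have [-> _|z0 mz] := eqVneq z 0.
  by exists 0; rewrite ?mulr0 //; apply: place0.
have [n [c lz]] := lead z z0.
have n0 := (leading_maxideal p0 mp lz).1 mz.
exists (z / p); last by rewrite mulrC divfK.
have := leadingM p0 lz (leadingV p0 (leading_self P p0)).
by move/(leading_place p0 mp) => h; apply/h; lia.
Qed.

Lemma local_parameter_rational P p : local_parameter P p -> rational_place P.
Proof.
move=> [p0 mp lead] z Pz.
have [->|z0] := eqVneq z 0; first by exists 0; apply/has_value0/maxideal0.
have [n [c lz]] := lead z z0.
have := (leading_place p0 mp lz).1 Pz.
rewrite le_eqVlt => /predU1P[n0|n0]; last first.
  by exists 0; apply/has_value0/(leading_maxideal p0 mp lz).
by exists c; case: lz => _; rewrite -n0 oppr0 expr0z mulr1.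
Qed.

Lemma uniformizer_maxideal P t : uniformizer P t -> maxideal P t.
Proof. by move=> ->; exists 1; rewrite ?mulr1 //; apply: place1. Qed.

Lemma uniformizer_neq0 P t : uniformizer P t -> t != 0.
Proof.
move=> ut; apply/eqP => t0; case: (vr_proper (place_ringP P)) => _; apply=> z _.
apply: contrapT => nPz; have := maxidealV nPz; rewrite ut t0 => -[w _].
rewrite mul0r => /esym/eqP; rewrite invr_eq0 => /eqP z0.
by apply: nPz; rewrite z0; apply: place0.
Qed.

Lemma ring_unitM P z w : ring_unit P z -> ring_unit P w -> ring_unit P (z * w).
Proof.
move=> [z0 Pz Pzi] [w0 Pw Pwi]; split; first by rewrite mulf_neq0.
  exact: placeM.
by rewrite invfM; apply: placeM.
Qed.

Lemma ring_unitV P z : ring_unit P z -> ring_unit P z^-1.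
Proof. by move=> [z0 Pz Pzi]; split; rewrite ?invr_eq0 ?invrK. Qed.

Lemma ring_unit_expz P z n : ring_unit P z -> ring_unit P (z ^ n).
Proof.
have hX k w : ring_unit P w -> ring_unit P (w ^+ k).
  move=> uw; elim: k => [|k IH]; last by rewrite exprS; apply: ring_unitM.
  by split; rewrite ?expr0 ?oner_eq0 ?invr1 //; apply: place1.
move=> uz; case: n => k; first exact: hX.
exact/ring_unitV/hX.
Qed.

Lemma ring_unit_maxideal P z : ring_unit P z -> ~ maxideal P z.
Proof. by move=> uz [_]. Qed.

Lemma has_value_unit P z c : c != 0 -> has_value P z c -> ring_unit P z.
Proof.
move=> c0 vz; split; first exact: has_value_neq0 vz.
  exact: has_value_place vz.
exact: has_value_place (has_valueV c0 vz).
Qed.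

(** Two uniformizers differ by a unit, and no nonzero power of a uniformizer is a
    unit. *)
Lemma valuationE P t n u z : uniformizer P t -> ring_unit P u ->
  z = t ^ n * u -> valuation P z = n.
Proof.
move=> ut uu zE; apply: xget_unique; first by exists t, u.
move=> m [s [v [us uv zE']]].
have t0 := uniformizer_neq0 ut; have s0 := uniformizer_neq0 us.
have [w Pw tE]: [set s * w | w in place_ring P]%classic t.
  by rewrite -us; apply: uniformizer_maxideal.
have [w' Pw' sE]: [set t * w | w in place_ring P]%classic s.
  by rewrite -ut; apply: uniformizer_maxideal.
have w0: w != 0 by apply: contraNneq t0 => w00; rewrite -tE w00 mulr0.
have uw: ring_unit P w.
  split=> //; suff <-: w' = w^-1 by [].
  apply: (mulfI s0); apply: (mulIf w0); rewrite mulfVK // -mulrA.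
  by rewrite [w' * w]mulrC mulrA tE sE.
have key: t ^ (n - m) = v * u^-1 * w ^ (- m).
  have u0: u != 0 by case: uu.
  apply: (mulIf u0); rewrite expfzDr // mulrAC -zE zE' -tE expfzMl.
  rewrite -!invr_expz; field.
  by rewrite u0 !expfz_neq0.
have uk: ring_unit P (t ^ (n - m)).
  rewrite key; apply: ring_unitM; last exact: ring_unit_expz.
  by apply: ring_unitM => //; apply: ring_unitV.
have mt := uniformizer_maxideal ut.
have nm k : ~ ring_unit P (t ^+ k.+1).
  by move/ring_unit_maxideal; apply; apply: maxidealX.
case nmE: (n - m) uk => [[|k]|k]; first by move=> _; lia.
  by move/nm.
by move/ring_unitV; rewrite NegzE -exprnN invrK => /nm.
Qed.

Lemma valuation_leading P p z n c : uniformizer P p ->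
  leading P p z n c -> valuation P z = n.
Proof.
move=> up [c0 vz]; have p0 := uniformizer_neq0 up.
apply: (valuationE up (has_value_unit c0 vz)).
by rewrite mulrCA -expfzDr // subrr expr0z mulr1.
Qed.

Lemma pole_not_integral P z : pole P z -> ~ place_ring P z.
Proof.
move=> [z0]; rewrite /valuation; case: xgetP => // n _ [t [u [ut uu zE]]] n0 Pz.
have mt := uniformizer_maxideal ut; have t0 := uniformizer_neq0 ut.
apply: (ring_unit_maxideal uu).
have ->: u = z * t ^ (- n) by rewrite zE mulrAC -expfzDr // subrr expr0z mul1r.
apply: maxidealMl => //; case: (n) n0 => // k _.
by rewrite NegzE opprK; apply: maxidealX.
Qed.

(** The proof component of a place carries no information. *)
Lemma place_eq P P' : (forall z, place_ring P z <-> place_ring P' z) -> P = P'.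
Proof.
case: P P' => [O h] [O' h'] /= eqO.
have e: O = O' by apply/seteqP; split=> z /eqO.
by case: O' / e h' {eqO} => h'; rewrite (Prop_irrelevance h h').
Qed.

(** Integrality of z is read off from its order, hence common leading terms force
    equal valuation rings. *)
Lemma leading_place_eq P P' p : p != 0 -> maxideal P p -> maxideal P' p ->
  (forall z, z != 0 -> exists n c, leading P p z n c /\ leading P' p z n c) ->
  P = P'.
Proof.
move=> p0 mp mp' lead; apply: place_eq => z.
have [->|/lead[n [c [l l']]]] := eqVneq z 0; first by split=> _; apply: place0.
by rewrite (leading_place p0 mp l) (leading_place p0 mp' l').
Qed.

(** The monomials of d have distinct orders at a pole of x, and the one of highest
    degree dominates.  The order of the pole is arbitrary because x has a simple pole
    in K(x) but a pole of order q in the Hermitian field. *)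
Lemma leading_horner_pole P p x e d : p != 0 -> maxideal P p -> (0 < e)%N ->
  leading P p x (- e%:Z) 1 -> d != 0 ->
  leading P p (map_poly iota d).[x] (- (e * (size d).-1)%:Z) (lead_coef d).
Proof.
move=> p0 mp e0 lx; elim/poly_ind: d => [|d c IH]; first by rewrite eqxx.
rewrite rmorphD rmorphM /= map_polyX map_polyC hornerMXaddC.
have [->|d0] := eqVneq d 0.
  rewrite mul0r add0r rmorph0 horner0 mul0r add0r polyC_eq0 => c0.
  by rewrite size_polyC c0 lead_coefC muln0; apply: leading_const.
move=> _; rewrite size_MXaddC (negPf d0) /= lead_coefDl; last first.
  by rewrite size_mulX // size_polyC ltnS (leq_trans (leq_b1 _)) // lt0n size_poly_eq0.
rewrite lead_coefMX; have {IH} lm := leadingM p0 (IH d0) lx.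
have s0 : (0 < size d)%N by rewrite lt0n size_poly_eq0.
have eN : - (e * (size d).-1)%:Z + - e%:Z = - (e * size d)%:Z.
  by rewrite -opprD -PoszD addnC -mulnS prednK.
rewrite eN mulr1 in lm.
have [->|c0] := eqVneq c 0; first by rewrite rmorph0 addr0.
apply: leadingD lm (leading_const P p c0) => //.
by rewrite oppr_lt0 ltz_nat muln_gt0 e0.
Qed.

Lemma has_value_horner P x a d :
  has_value P x a -> has_value P (map_poly iota d).[x] d.[a].
Proof.
move=> vx; elim/poly_ind: d => [|d c IH].
  by rewrite rmorph0 !horner0; apply/has_value0/maxideal0.
rewrite rmorphD rmorphM /= map_polyX map_polyC !hornerMXaddC.
by apply: has_valueD; [apply: has_valueM|apply: has_valueC].
Qed.

End Expansion.

(** The order is the multiplicity of a as a root of d; it is fixed before the field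
    E and the place are given, so the leading term is common to all of them. *)
Lemma leading_horner_zero (K : fieldType) (a : K) (d : {poly K}) : d != 0 ->
  exists (k : nat) (c : K), forall (E : fieldType) (iota : {rmorphism K -> E})
    (P : place iota) (x : E), x - iota a != 0 -> has_value P x a ->
    leading P (x - iota a) (map_poly iota d).[x] k c.
Proof.
move=> d0; have [k [q nq dE]] := multiplicity_XsubC d a.
rewrite d0 /= in nq; exists k, q.[a] => E iota P x p0 vx.
split=> //; rewrite dE rmorphM rmorphXn rmorphB /= map_polyX map_polyC /=.
rewrite hornerM horner_exp hornerXsubC exprnP -mulrA -expfzDr // subrr expr0z mulr1.
exact: has_value_horner.
Qed.

(** * The rational function field *)
Section RationalFunctions.
Context (K : fieldType).

Lemma ratfun_fraction (u : ratfun K) :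
  exists n d : {poly K}, d != 0 /\ u = tofrac n / tofrac d.
Proof.
exists (\n_(repr u)), (\d_(repr u)); split; first exact: denom_ratioP.
have d0 : \d_(repr u) != 0 by apply: denom_ratioP.
have f0 : tofrac (\d_(repr u)) != 0 by rewrite tofrac_eq0.
apply: (mulIf f0); rewrite divfK // -[u in LHS]reprK; unlock tofrac.
rewrite -[LHS]FracField.pi_mul; apply/eqmodP; rewrite /= /FracField.equivf.
by rewrite /FracField.mulf !numden_Ratio ?mulr1 ?mulf_neq0 ?oner_eq0 // reprK mulrC.
Qed.

Context (E : fieldType) (iota : {rmorphism K -> E}).

Section Composite.
Context (j : {rmorphism ratfun K -> E}) (hj : forall c, j (ratfun_const K c) = iota c).

Lemma ratfun_horner (d : {poly K}) :
  j (tofrac d) = (map_poly iota d).[j (ratfun_x K)].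
Proof.
elim/poly_ind: d => [|d c IH]; first by rewrite !rmorph0 horner0.
rewrite !rmorphD !rmorphM /= map_polyX map_polyC hornerMXaddC IH.
congr (_ + _); exact: hj.
Qed.

End Composite.
End RationalFunctions.

(** An element of K(x) has one and the same leading term at all poles of x, in K(x)
    itself (j the identity) and in its extensions E, up to multiplying the order
    by the pole order e. *)
Lemma leading_ratfun_pole (K : fieldType) (u : ratfun K) : u != 0 ->
  exists (k : int) (c : K), forall (E : fieldType) (iota : {rmorphism K -> E})
    (j : {rmorphism ratfun K -> E}), (forall c, j (ratfun_const K c) = iota c) ->
  forall (P : place iota) (p : E) (e : nat), p != 0 -> maxideal P p -> (0 < e)%N ->
    leading P p (j (ratfun_x K)) (- e%:Z) 1 -> leading P p (j u) (e%:Z * k) c.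
Proof.
have [n [d [d0 ->]]] := ratfun_fraction u.
rewrite mulf_eq0 tofrac_eq0 => /norP[n0 _].
exists ((size d).-1%:Z - (size n).-1%:Z), (lead_coef n / lead_coef d).
move=> E iota j hj P p e p0 mp e0 lx.
rewrite fmorph_div (ratfun_horner hj n) (ratfun_horner hj d).
have := leadingM p0 (leading_horner_pole p0 mp e0 lx n0)
                    (leadingV p0 (leading_horner_pole p0 mp e0 lx d0)).
by rewrite opprK addrC !PoszM -mulrBr.
Qed.

Lemma leading_ratfun_zero (K : fieldType) (a : K) (u : ratfun K) : u != 0 ->
  exists (k : int) (c : K), forall (E : fieldType) (iota : {rmorphism K -> E})
    (j : {rmorphism ratfun K -> E}), (forall c, j (ratfun_const K c) = iota c) ->
  forall P : place iota, has_value P (j (ratfun_x K)) a ->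
    leading P (j (ratfun_x K) - iota a) (j u) k c.
Proof.
have [n [d [d0 ->]]] := ratfun_fraction u.
rewrite mulf_eq0 tofrac_eq0 => /norP[n0 _].
have [kn [cn hn]] := leading_horner_zero a n0.
have [kd [cd hd]] := leading_horner_zero a d0.
exists (kn%:Z - kd%:Z), (cn / cd) => E iota j hj P vx.
have p0 : j (ratfun_x K) - iota a != 0.
  rewrite -hj -rmorphB fmorph_eq0 /= -tofracB tofrac_eq0.
  by rewrite polyXsubC_eq0.
rewrite fmorph_div (ratfun_horner hj n) (ratfun_horner hj d).
exact: leadingM (hn _ _ _ _ p0 vx) (leadingV p0 (hd _ _ _ _ p0 vx)).
Qed.

(** * Extending ring morphisms to fractions *)
Section FractionExtension.
Context (A : comNzRingType) (E E' : fieldType).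
Context (f : {rmorphism A -> E}) (g : {rmorphism A -> E'}).
Context (fg_ker : forall a, f a = 0 -> g a = 0).
Context (f_frac : forall z, exists a b, g b != 0 /\ z * f b = f a).

(** If E consists of fractions of values of f, the only possible definition is
    s (f a / f b) = g a / g b.  It is used twice: to pass from polynomials to rational
    functions, and from polynomials in y to the Hermitian field, where
    b = 1 but f has a kernel. *)
Lemma fraction_extension : exists s : {rmorphism E -> E'}, forall a, s (f a) = g a.
Proof.
have eqfg a b : f a = f b -> g a = g b.
  move=> fab; apply/eqP; rewrite -subr_eq0 -rmorphB; apply/eqP/fg_ker.
  by rewrite rmorphB fab subrr.
have f0 b : g b != 0 -> f b != 0.
  by apply: contra_neq => /fg_ker.
have hs z : exists w, forall a b, g b != 0 -> z * f b = f a -> w * g b = g a.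
  have [a [b [gb zE]]] := f_frac z; exists (g a / g b) => c d gd zE'.
  rewrite mulrAC; apply: (mulIf gb); rewrite divfK // -!rmorphM; apply: eqfg.
  by rewrite !rmorphM -zE -zE' mulrAC.
have [s sE] := choice hs.
have sB : {morph s : z w / z - w}.
  move=> z w; have [a [b [gb zE]]] := f_frac z; have [c [d [gd wE]]] := f_frac w.
  apply: (mulIf gb); apply: (mulIf gd); rewrite -mulrA -rmorphM.
  rewrite (sE (z - w) (a * d - c * b)) ?rmorphM ?mulf_neq0 //; last first.
    by rewrite rmorphB !rmorphM -zE -wE; ring.
  by rewrite rmorphB !rmorphM -(sE _ _ _ gb zE) -(sE _ _ _ gd wE); ring.
have sM : {morph s : z w / z * w}.
  move=> z w; have [a [b [gb zE]]] := f_frac z; have [c [d [gd wE]]] := f_frac w.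
  apply: (mulIf gb); apply: (mulIf gd); rewrite -mulrA -rmorphM.
  rewrite (sE (z * w) (a * c)) ?rmorphM ?mulf_neq0 //; last first.
    by rewrite -zE -wE; ring.
  by rewrite -(sE _ _ _ gb zE) -(sE _ _ _ gd wE); ring.
have sf a : s (f a) = g a.
  by have := sE (f a) a 1; rewrite !rmorph1 !mulr1; apply; rewrite ?oner_eq0.
have s1 : s 1 = 1 by rewrite -(rmorph1 f) sf rmorph1.
pose sZ := GRing.isZmodMorphism.Build E E' s sB.
pose sR := GRing.isMonoidMorphism.Build E E' s (conj s1 sM).
pose S : {rmorphism E -> E'} := HB.pack s sZ sR.
by exists S.
Qed.
End FractionExtension.

(** * Inverse images of places *)
Section Pullback.
Context (K E1 E2 : fieldType).
Context (iota1 : {rmorphism K -> E1}) (iota2 : {rmorphism K -> E2}).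
Context (j : {rmorphism E1 -> E2}) (hj : forall c, j (iota1 c) = iota2 c).

(** The element t guarantees that the inverse image of the valuation ring is
    neither the field of constants nor the whole field: it contains t, but not t^-1. *)
Lemma pullback_place (P : place iota2) (t : E1) : t != 0 -> maxideal P (j t) ->
  exists P1 : place iota1, forall z, place_ring P1 z <-> place_ring P (j z).
Proof.
move=> t0 mt.
suff V : valuation_ring iota1 [set z | place_ring P (j z)]%classic.
  by exists (Place V).
have ntV : ~ place_ring P (j t^-1).
  by rewrite fmorphV; apply: maxidealVN; rewrite ?fmorph_eq0.
split=> /=.
- by rewrite rmorph1; apply: place1.
- by move=> z w Pz Pw; rewrite rmorphB; apply: placeB.
- by move=> z w Pz Pw; rewrite rmorphM; apply: placeM.
- split; first by move=> _ [c _ <-] /=; rewrite hj; apply: place_const.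
  move=> /(_ t) /= h; have [|c _ ct] := h; first exact: maxideal_place.
  by apply: ntV; rewrite -ct -fmorphV hj; apply: place_const.
- by split=> // /(_ t^-1 I).
- by move=> z; rewrite fmorphV; apply: (vr_total (place_ringP P)).
Qed.

Section PullbackTheory.
Context (P : place iota2) (P1 : place iota1).
Context (PE : forall z, place_ring P1 z <-> place_ring P (j z)).

Lemma pullback_maxideal z : maxideal P1 z <-> maxideal P (j z).
Proof.
rewrite !maxidealP !PE fmorphV.
by split=> -[Pz [z0|nz]]; split=> //; [left|right|left|right]; rewrite ?z0 ?rmorph0 //;
  apply/eqP; rewrite -(fmorph_eq0 j) z0.
Qed.

Lemma pullback_value z c : has_value P1 z c <-> has_value P (j z) c.
Proof. by rewrite /has_value pullback_maxideal rmorphB hj. Qed.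

End PullbackTheory.
End Pullback.

(** * The Hermitian field at infinity *)
Section HermitianField.
Context (K : fieldType) (q : nat) (q1 : (1 < q)%N).
Context (H : fieldExtType (ratfun K)) (y : H) (hH : hermitian_field q y).
Local Notation iotaH := (ext_const (ratfun_const K) H).
Local Notation placeH := (place iotaH).
Local Notation x := (herm_x H).
Local Notation jH := (in_alg H : {rmorphism ratfun K -> H}).
Local Notation pi_inf := (x / y).

Let hermE : y ^+ q + y = x ^+ q.+1 := hH.2.

Lemma herm_leading_inf (P : placeH) : ~ place_ring P x ->
  [/\ pi_inf != 0, maxideal P pi_inf, leading P pi_inf x (- q%:Z) 1
    & leading P pi_inf y (- q.+1%:Z) 1].
Proof.
move=> nPx.
have x0 : x != 0 by apply: contra_notN nPx => /eqP ->; apply: place0.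
have nPy : ~ place_ring P y.
  move=> Py; apply: (@maxideal1 _ _ _ P).
  have <- : (y ^+ q + y) * x^-1 ^+ q.+1 = 1.
    by rewrite hermE exprVn divff // expf_neq0.
  apply: maxidealMl; first by apply: placeD => //; apply: placeX.
  by apply: maxidealX => //; apply: maxidealV.
have y0 : y != 0 by apply: contra_notN nPy => /eqP ->; apply: place0.
have p0 : pi_inf != 0 by rewrite mulf_neq0 ?invr_eq0.
have v1 : has_value P (1 + y^-1 ^+ q.-1) 1.
  rewrite -[X in has_value _ _ X]addr0; apply: has_valueD (has_value1 P) _.
  by apply/has_value0/maxidealX; [rewrite -ltnS prednK // ltnW | apply: maxidealV].
(* Both x (x/y)^q and y (x/y)^(q+1) are equal to x^(q+1) / y^q, a unit of value 1. *)
have eq1 : x ^+ q.+1 / y ^+ q = 1 + y^-1 ^+ q.-1.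
  rewrite -hermE mulrDl divff ?expf_neq0 // exprVn; congr (_ + _).
  by rewrite -{1}(prednK (ltnW q1)) exprS invfM mulrA divff // mul1r.
have xE : x * pi_inf ^+ q = 1 + y^-1 ^+ q.-1 by rewrite -eq1 expr_div_n mulrA -exprS.
have yE : y * pi_inf ^+ q.+1 = 1 + y^-1 ^+ q.-1.
  by rewrite -eq1 expr_div_n mulrCA [y ^+ q.+1]exprS invfM mulVKf.
split=> //.
- apply: contrapT => npi; have Ppi : place_ring P pi_inf^-1.
    by apply: contrapT => /maxidealV; rewrite invrK.
  apply: nPx; have -> : x = (1 + y^-1 ^+ q.-1) * pi_inf^-1 ^+ q.
    by rewrite -xE exprVn mulfK // expf_neq0.
  by apply: placeM (has_value_place v1) _; apply: placeX.
- by split; rewrite ?oner_eq0 // opprK -exprnP xE.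
- by split; rewrite ?oner_eq0 // opprK -exprnP yE.
Qed.

(** The term of degree i in y has order -(q k + i (q+1)) for some k, which is
    congruent to -i modulo q; as i < q, no two terms have the same order and no
    cancellation of dominating terms can occur.  The bound i < size r in the
    statement keeps track of these residues through the induction on r. *)
Lemma leading_reduced_inf (r : {poly ratfun K}) : r != 0 -> (size r <= q)%N ->
  exists (k : int) (i : nat) (c : K), (i < size r)%N /\
  forall P : placeH, ~ place_ring P x ->
    leading P pi_inf (map_poly jH r).[y] (- (q%:Z * k + i%:Z)) c.
Proof.
elim/poly_ind: r => [|r u IH]; first by rewrite eqxx.
rewrite rmorphD rmorphM /= map_polyX map_polyC hornerMXaddC.
have uE : u != 0 -> exists (k : int) (c : K), forall P : placeH, ~ place_ring P x ->
    leading P pi_inf (jH u) (- (q%:Z * k + 0%:Z)) c.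
  move=> u0; have [k [c kc]] := leading_ratfun_pole u0.
  exists (- k), c => P nPx; have [p0 mp lx _] := herm_leading_inf nPx.
  rewrite addr0 -mulrN opprK.
  exact: (kc _ iotaH jH (fun=> erefl) P _ _ p0 mp (ltnW q1) lx).
have [->|r0] := eqVneq r 0.
  rewrite mul0r add0r polyC_eq0 => u0 _; have [k [c kc]] := uE u0.
  exists k, 0%N, c; rewrite size_polyC u0; split=> // P nPx.
  by rewrite map_poly0 horner0 mul0r add0r; apply: kc.
move=> _; rewrite size_MXaddC (negPf r0) /= => szr.
have [k [i [c [lti hr]]]] := IH r0 (ltnW szr).
have hry (P : placeH) : ~ place_ring P x ->
    leading P pi_inf ((map_poly jH r).[y] * y) (- (q%:Z * (k + 1) + i.+1%:Z)) c.
  move=> nPx; have [p0 mp _ ly] := herm_leading_inf nPx.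
  have := leadingM p0 (hr P nPx) ly; rewrite mulr1.
  by congr (leading _ _ _ _ _); lia.
have [u0|/uE [k' [c' hu]]] := eqVneq u 0.
  exists (k + 1), i.+1, c; split; first by rewrite ltnS.
  by move=> P nPx; rewrite u0 scale0r addr0; apply: hry.
have [lt|lt|eq] := ltgtP (q%:Z * (k + 1) + i.+1%:Z) (q%:Z * k' + 0%:Z).
- exists k', 0%N, c'; split=> // P nPx; have [p0 mp _ _] := herm_leading_inf nPx.
  by rewrite addrC; apply: leadingD (hu P nPx) (hry P nPx) => //; rewrite ltrN2.
- exists (k + 1), i.+1, c; split=> [|P nPx]; first by rewrite ltnS.
  have [p0 mp _ _] := herm_leading_inf nPx.
  by apply: leadingD (hry P nPx) (hu P nPx) => //; rewrite ltrN2.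
(* Equal orders would make i + 1 a multiple of q, against 0 < i + 1 < q. *)
- have iE : i.+1%:Z = q%:Z * (k' - k - 1) by rewrite addr0 in eq; lia.
  have iq : (i.+1 < q)%N by apply: leq_trans szr; rewrite ltnS.
  exfalso; move: (k' - k - 1) iE => d iE.
  have [d0|d0] := leP d 0; first by nia.
  by nia.
Qed.

Definition herm_poly : {poly ratfun K} := 'X^q + 'X - (ratfun_x K ^+ q.+1)%:P.

Lemma size_herm_poly : size herm_poly = q.+1.
Proof.
rewrite /herm_poly -addrA size_polyDl size_polyXn //.
by rewrite size_XsubC ltnS.
Qed.

Lemma herm_poly_root (X Z : H) (s : {rmorphism ratfun K -> H}) :
  s (ratfun_x K) = X -> Z ^+ q + Z = X ^+ q.+1 -> (map_poly s herm_poly).[Z] = 0.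
Proof.
move=> sX eqZ; rewrite !rmorphB rmorphD /= map_polyXn map_polyX map_polyC /=.
by rewrite !hornerE rmorphXn sX eqZ subrr.
Qed.

Lemma map_poly_modp_herm (X Z : H) (s : {rmorphism ratfun K -> H})
    (p : {poly ratfun K}) :
  s (ratfun_x K) = X -> Z ^+ q + Z = X ^+ q.+1 ->
  (map_poly s (p %% herm_poly)).[Z] = (map_poly s p).[Z].
Proof.
move=> sX eqZ; rewrite {2}(divp_eq p herm_poly) rmorphD rmorphM hornerD hornerM.
by rewrite (herm_poly_root sX eqZ) mulr0 add0r.
Qed.

Lemma herm_polyP (z : H) : exists p, z = (map_poly jH p).[y].
Proof. by apply/Fadjoin1_polyP; rewrite hH.1 memvf. Qed.

Lemma herm_reducedP (z : H) : exists2 r, z = (map_poly jH r).[y] & (size r <= q)%N.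
Proof.
have [p ->] := herm_polyP z.
exists (p %% herm_poly); first by rewrite (map_poly_modp_herm (X := x)).
rewrite -ltnS -size_herm_poly ltn_modp -size_poly_eq0 size_herm_poly //.
Qed.

(** The order and the coefficient are chosen before the place: this is what makes
    the pole of x unique, and what [leading_affine] transports to the
    other places. *)
Lemma leading_inf z : z != 0 -> exists n c,
  forall P : placeH, ~ place_ring P x -> leading P pi_inf z n c.
Proof.
have [r -> sr] := herm_reducedP z => z0.
have r0 : r != 0 by apply: contra_neq z0 => ->; rewrite rmorph0 horner0.
have [k [i [c [_ h]]]] := leading_reduced_inf r0 sr.
by exists (- (q%:Z * k + i%:Z)), c.
Qed.

Lemma place_inf_unique (P P' : placeH) :
  ~ place_ring P x -> ~ place_ring P' x -> P = P'.
Proof.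
move=> nP nP'; have [p0 mp _ _] := herm_leading_inf nP.
have [_ mp' _ _] := herm_leading_inf nP'.
apply: leading_place_eq p0 mp mp' _ => z /leading_inf[n [c h]].
by exists n, c; split; apply: h.
Qed.

Lemma local_parameter_inf (P : placeH) : ~ place_ring P x -> local_parameter P pi_inf.
Proof.
move=> nP; have [p0 mp _ _] := herm_leading_inf nP; split=> // z /leading_inf[n [c h]].
by exists n, c; apply: h.
Qed.

Context (Q : placeH) (nQ : ~ place_ring Q x).

(** A reduced expression has a leading term at the place Q, so it does not vanish. *)
Lemma herm_reduced_free (r : {poly ratfun K}) :
  (size r <= q)%N -> (map_poly jH r).[y] = 0 -> r = 0.
Proof.
move=> sr ry0; apply: contrapT => /eqP r0.
have [k [i [c [_ h]]]] := leading_reduced_inf r0 sr.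
by have := leading_neq0 (h Q nQ); rewrite ry0 eqxx.
Qed.

Lemma dim_herm : \dim {:H} = q.
Proof.
have y0 := herm_poly_root (s := jH) (erefl _) hermE.
rewrite -hH.1 dim_Fadjoin dimv1 muln1.
have [m mE] : exists m, minPoly 1 y = map_poly jH m.
  by have /polyOver1P[m ->] := minPolyOver 1 y; exists m.
apply/eqP; rewrite eqn_leq; apply/andP; split.
  rewrite -ltnS -(size_minPoly 1 y) -size_herm_poly -(size_map_poly jH).
  apply: dvdp_leq; last first.
    by apply: minPoly_dvdp; [apply: alg_polyOver | apply/rootP].
  by rewrite map_poly_eq0 -size_poly_eq0 size_herm_poly.
rewrite leqNgt; apply/negP => lt.
have m0 : m = 0.
  apply: herm_reduced_free; first by rewrite -(size_map_poly jH) -mE size_minPoly.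
  by rewrite -mE minPolyxx.
by have := size_minPoly 1 y; rewrite mE m0 rmorph0 size_poly0.
Qed.

(** The polynomials over F that vanish at y are, by [herm_reduced_free], the multiples
    of the Hermitian polynomial, so any solution (X, Z) of the Hermitian equation with X
    transcendental over K is the image of (x, y). *)
Lemma herm_hom (X Z : H) :
  (forall d : {poly K}, d != 0 -> (map_poly iotaH d).[X] != 0) ->
  Z ^+ q + Z = X ^+ q.+1 ->
  exists s : {rmorphism H -> H},
    [/\ forall c, s (iotaH c) = iotaH c, s x = X & s y = Z].
Proof.
move=> trX eqZ.
pose g : {rmorphism {poly K} -> H} := horner_eval X \o map_poly iotaH.
have gE d : g d = (map_poly iotaH d).[X] by [].
have [s0 s0E] : exists s0 : {rmorphism ratfun K -> H}, forall d : {poly K},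
    s0 (tofrac d) = g d.
  apply: fraction_extension => [d /eqP|u].
    by rewrite tofrac_eq0 => /eqP ->; rewrite rmorph0.
  have [n [d [d0 ->]]] := ratfun_fraction u.
  exists n, d; split; first by rewrite gE trX.
  by rewrite divfK // tofrac_eq0.
have s0c c : s0 (ratfun_const K c) = iotaH c.
  by rewrite /ratfun_const /= s0E gE map_polyC hornerC.
have s0x : s0 (ratfun_x K) = X.
  by rewrite /ratfun_x s0E gE map_polyX hornerX.
pose f : {rmorphism {poly ratfun K} -> H} := horner_eval y \o map_poly jH.
pose g1 : {rmorphism {poly ratfun K} -> H} := horner_eval Z \o map_poly s0.
have fE p : f p = (map_poly jH p).[y] by [].
have g1E p : g1 p = (map_poly s0 p).[Z] by [].
have [s sE] : exists s : {rmorphism H -> H}, forall p, s (f p) = g1 p.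
  apply: fraction_extension => [p|z].
    rewrite fE -(map_poly_modp_herm (X := x)) // => /herm_reduced_free h.
    rewrite g1E -(map_poly_modp_herm p s0x eqZ) h ?rmorph0 ?horner0 //.
    by rewrite -ltnS -size_herm_poly ltn_modp -size_poly_eq0 size_herm_poly.
  have [p ->] := herm_polyP z.
  by exists p, 1; rewrite !rmorph1 mulr1 oner_eq0.
have sC u : s (jH u) = s0 u.
  by have := sE u%:P; rewrite fE g1E !map_polyC !hornerC.
exists s; split.
- by move=> c; rewrite -[RHS]s0c -sC.
- by rewrite -[RHS]s0x -sC.
- by have := sE 'X; rewrite fE g1E !map_polyX !hornerX.
Qed.

Lemma herm_hom_id (s : {rmorphism H -> H}) :
  (forall c, s (iotaH c) = iotaH c) -> s x = x -> s y = y -> s =1 id.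
Proof.
move=> sc sx sy.
have sF u : s (jH u) = jH u.
  have [n [d [d0 ->]]] := ratfun_fraction u.
  have sP e : s (jH (tofrac e)) = jH (tofrac e).
    have -> := ratfun_horner (iota := iotaH) (j := jH) (fun=> erefl) e.
    rewrite -horner_map -map_poly_comp sx; congr (_.[_]).
    exact: eq_map_poly.
  by rewrite [jH _]fmorph_div [s _]fmorph_div !sP.
move=> z; have [p ->] := herm_polyP z.
rewrite -horner_map sy -map_poly_comp; congr (_.[_]).
by apply: eq_map_poly => u /=; apply: sF.
Qed.

End HermitianField.

(** * The affine places of the Hermitian field *)
Section ScalarEmbedding.
Context (F : fieldType) (L : fieldExtType F).

(** Instances of [rmorphB] and [fmorphV] that keep [in_alg] folded, for rewriting in
    extensions of a field of fractions, where simplification is costly. *)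
Lemma in_algB (u w : F) : in_alg L (u - w) = in_alg L u - in_alg L w.
Proof. exact: rmorphB. Qed.

Lemma in_algV (u : F) : in_alg L u^-1 = (in_alg L u)^-1.
Proof. exact: fmorphV. Qed.

End ScalarEmbedding.

Section AffinePlaces.
Context (K : fieldType) (q : nat) (q1 : (1 < q)%N).
Context (pq : (GRing.pchar K).-nat q) (Kq : forall a : K, a ^+ q ^+ q = a).
Context (H : fieldExtType (ratfun K)) (y : H) (hH : hermitian_field q y).
Local Notation iotaH := (ext_const (ratfun_const K) H).
Local Notation placeH := (place iotaH).
Local Notation x := (herm_x H).
Let hermE : y ^+ q + y = x ^+ q.+1 := hH.2.

(** Additivity of the q-th power makes the mixed terms of X^(q+1) cancel, and
    the q-th power of a^q t contributes a t^q because a^(q^2) = a. *)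
Lemma herm_translate (a b : K) (t v : H) : b ^+ q + b = a ^+ q.+1 ->
  let X := iotaH a + t in let Y := iotaH b + iotaH (a ^+ q) * t + v in
  Y ^+ q + Y - X ^+ q.+1 = v ^+ q + v - t ^+ q.+1.
Proof.
move=> ab X Y; have pH : (GRing.pchar H).-nat q.
  by apply: sub_in_pnat pq => p _; rewrite (fmorph_pchar iotaH).
rewrite /Y /X [in X in _ - X]exprSr !(exprDn_pchar _ _ pH) exprMn -!rmorphXn Kq exprSr.
have -> : iotaH (b ^+ q) = iotaH a ^+ q * iotaH a - iotaH b.
  by rewrite -[iotaH a ^+ q]rmorphXn -rmorphM -rmorphB -exprSr -ab addrK.
by rewrite !rmorphXn; ring.
Qed.

(** Divide the equation by v^(q+1). *)
Lemma herm_invert (t v : H) : v != 0 -> v ^+ q + v = t ^+ q.+1 ->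
  v^-1 ^+ q + v^-1 = (t / v) ^+ q.+1.
Proof.
move=> v0 e; rewrite expr_div_n -e exprVn exprS mulrDl invfM.
rewrite [X in _ = _ + X]mulVKf // [X in _ = X + _]mulrCA divff ?expf_neq0 //.
by rewrite mulr1 addrC.
Qed.

Lemma in_alg_ratfun_x : in_alg H (ratfun_x K) = x.
Proof. exact: in_algE. Qed.

Lemma in_alg_ratfun_x_const (a : K) :
  in_alg H (ratfun_x K - ratfun_const K a) = x - iotaH a.
Proof. by rewrite in_algB in_alg_ratfun_x. Qed.

Lemma herm_x_neq_const (a : K) : x - iotaH a != 0.
Proof.
by rewrite -in_alg_ratfun_x_const fmorph_eq0 -tofracB tofrac_eq0 polyXsubC_eq0.
Qed.

Section OnePlace.
Context (a b : K) (ab : b ^+ q + b = a ^+ q.+1).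
Local Notation t := (x - iotaH a).
Local Notation v := (y - iotaH b - iotaH (a ^+ q) * t).

Lemma affine_eq : v ^+ q + v = t ^+ q.+1.
Proof.
apply/eqP; rewrite -subr_eq0 -(herm_translate t v ab) subr_eq0; apply/eqP.
have -> : iotaH a + t = x by rewrite addrC subrK.
by rewrite [_ + v]addrC -[v]addrA -opprD subrK.
Qed.

Lemma affine_v_neq0 : v != 0.
Proof.
apply: contraNneq (herm_x_neq_const a) => v0.
suff : t ^+ q.+1 == 0 by rewrite expf_eq0.
by rewrite -affine_eq v0 expr0n addr0 gtn_eqF // ltnW.
Qed.

(** From v (1 + v^(q-1)) = t^(q+1) the quotient v/t is t^q times a unit. *)
Lemma affine_value (P : placeH) : has_value P x a -> has_value P y b ->
  maxideal P v /\ maxideal P (v / t).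
Proof.
move=> mt mb; have mv : maxideal P v.
  by apply: maxidealB => //; apply: maxidealMl => //; apply: place_const.
have t0 := herm_x_neq_const a; split=> //.
have u1 : has_value P (1 + v ^+ q.-1) 1.
  rewrite -[X in has_value _ _ X]addr0; apply: has_valueD (has_value1 P) _.
  by apply/has_value0/maxidealX => //; rewrite -ltnS prednK // ltnW.
have u0 := has_value_neq0 (oner_neq0 K) u1.
have -> : v / t = t ^+ q * (1 + v ^+ q.-1)^-1.
  apply: (mulIf u0); rewrite [RHS]divfK // mulrAC.
  have -> : v * (1 + v ^+ q.-1) = t ^+ q.+1.
    by rewrite -affine_eq mulrDr mulr1 -exprS prednK ?(ltnW q1) // addrC.
  by rewrite exprSr mulfK.
apply: maxidealMr; first by apply: maxidealX => //; apply: ltnW.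
exact: has_value_place (has_valueV (oner_neq0 K) u1).
Qed.

Context (Q : placeH) (nQ : ~ place_ring Q x).

(** The pair (x/y, 1/y) satisfies the equation of (t, v) and has value (0, 0) at Q. *)
Lemma affine_to_inf : exists s : {rmorphism H -> H},
  [/\ forall c, s (iotaH c) = iotaH c, s t = x / y & s v = y^-1].
Proof.
have [p0 mp _ ly] := herm_leading_inf q1 hH nQ.
have y0 := leading_neq0 ly.
set X := iotaH a + x / y.
set Y := iotaH b + iotaH (a ^+ q) * (x / y) + y^-1.
have XY : Y ^+ q + Y = X ^+ q.+1.
  apply/eqP; rewrite -subr_eq0 (herm_translate (x / y) y^-1 ab) subr_eq0.
  exact/eqP/herm_invert.
have Xa : X - iotaH a = x / y by rewrite /X addrC addKr.
have [d d0|s [sc sx sy]] := herm_hom q1 hH nQ _ XY.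
  have [k [c h]] := leading_horner_zero a d0.
  by apply: leading_neq0 (h _ _ Q X _ _); rewrite /has_value Xa.
have st : s t = x / y by rewrite rmorphB sx sc.
exists s; split=> //; rewrite [s _]rmorphB rmorphB [s (_ * t)]rmorphM st sy !sc.
by rewrite -[_ - _ - _]addrA -opprD addrC addKr.
Qed.

(** Pull back the place Q along [affine_to_inf]. *)
Lemma affine_place_exists : exists P : placeH, has_value P x a /\ has_value P y b.
Proof.
have [p0 mp _ ly] := herm_leading_inf q1 hH nQ.
have [s [sc st sv]] := affine_to_inf.
have [|P PE] := pullback_place sc (herm_x_neq_const a) (P := Q); first by rewrite st.
have mt : maxideal P t by apply/(pullback_maxideal PE); rewrite st.
exists P; split=> //; rewrite /has_value.
have -> : y - iotaH b = v + iotaH (a ^+ q) * t by rewrite subrK.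
apply: maxidealD; last by apply: maxidealMl => //; apply: place_const.
apply/(pullback_maxideal PE); rewrite sv.
by apply/(leading_maxideal p0 mp (leadingV p0 ly)); rewrite opprK.
Qed.

(** The element t/v is transcendental over K because it has a pole at a place
    P_(a, b), whose existence is known at this point. *)
Lemma inf_to_affine : exists s : {rmorphism H -> H},
  [/\ forall c, s (iotaH c) = iotaH c, s x = t / v & s y = v^-1].
Proof.
have [P [Pa Pb]] := affine_place_exists.
have [mv mvt] := affine_value Pa Pb.
have v0 := affine_v_neq0; have t0 := herm_x_neq_const a.
have tv := herm_invert v0 affine_eq.
apply: (herm_hom q1 hH nQ _ tv) => d d0.
have p0 : v / t != 0 by rewrite mulf_neq0 ?invr_eq0.
have lx : leading P (v / t) (t / v) (- 1%:Z) 1.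
  rewrite -[t / v]invf_div -[X in leading _ _ _ _ X]invr1.
  by apply: leadingV p0 (leading_self P p0).
exact: leading_neq0 (leading_horner_pole p0 mvt (ltn0Sn 0) lx d0).
Qed.

(** Let r be the endomorphism of [inf_to_affine] and s that of [affine_to_inf].  At a
    place P_(a, b) the inverse image along r has a pole at x, so s z has there the
    leading term common to all poles of x, with respect to x/y; applying r, which
    satisfies r (s z) = z and r (x/y) = t, gives the expansion of z. *)
Lemma leading_affine z : z != 0 -> exists n c, forall P : placeH,
  has_value P x a -> has_value P y b -> leading P t z n c.
Proof.
move=> z0; have [s [sc st sv]] := affine_to_inf.
have [r [rc rx ry]] := inf_to_affine.
have v0 := affine_v_neq0; have t0 := herm_x_neq_const a.
have rxy : r (x / y) = t by rewrite fmorph_div rx ry invrK divfK.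
(* r o s fixes K, x and y, hence everything. *)
have rs : r (s z) = z.
  apply: (herm_hom_id hH (s := r \o s)) => /=.
  - by move=> c; rewrite sc rc.
  - have -> : s x = s t + iotaH a by rewrite rmorphB sc subrK.
    by rewrite st rmorphD rxy rc subrK.
  - have -> : s y = s v + s (iotaH (a ^+ q) * t) + s (iotaH b).
      by rewrite -!rmorphD !subrK.
    by rewrite sv rmorphM st !sc !rmorphD rmorphM !rc rxy fmorphV ry invrK !subrK.
have sz0 : s z != 0 by rewrite fmorph_eq0.
have [n [c h]] := leading_inf q1 hH sz0.
exists n, c => P Pa Pb; have [mv mvt] := affine_value Pa Pb.
have x0 : x != 0 by apply: contra_notN nQ => /eqP ->; apply: place0.
have rx1 : r x^-1 = v / t by rewrite fmorphV rx invf_div.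
have [||P1 PE] := pullback_place rc (t := x^-1) (P := P).
- by rewrite invr_eq0.
- by rewrite rx1.
have nP1 : ~ place_ring P1 x.
  rewrite PE rx -[t / v]invf_div; apply: maxidealVN => //.
  by rewrite mulf_neq0 ?invr_eq0.
have [c0 /(pullback_value rc PE)] := h P1 nP1.
by rewrite rmorphM rs fmorphXz rxy.
Qed.

Lemma affine_place_unique (P P' : placeH) :
  has_value P x a -> has_value P y b -> has_value P' x a -> has_value P' y b -> P = P'.
Proof.
move=> Pa Pb P'a P'b.
apply: (leading_place_eq (herm_x_neq_const a) Pa P'a) => z /leading_affine[n [c h]].
by exists n, c; split; apply: h.
Qed.

Lemma affine_local_parameter (P : placeH) :
  has_value P x a -> has_value P y b -> local_parameter P t.
Proof.
move=> Pa Pb; split=> [||z /leading_affine[n [c h]]]; first exact: herm_x_neq_const.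
  exact: Pa.
by exists n, c; apply: h.
Qed.

End OnePlace.

(** The element y is integral over K[x]. *)
Lemma place_ring_y (P : placeH) : place_ring P x -> place_ring P y.
Proof.
move=> Px; apply: contrapT => nPy; have my := maxidealV nPy.
have y0 : y != 0 by apply: contra_notN nPy => /eqP ->; apply: place0.
apply: (@maxideal1 _ _ _ P).
have <- : x ^+ q.+1 * y^-1 ^+ q - y^-1 ^+ q.-1 = 1.
  rewrite -hermE mulrDl -exprMn divff // expr1n -[in y * _](prednK (ltnW q1)).
  by rewrite exprS mulrA divff // mul1r addrK.
apply: maxidealB; last by apply: maxidealX => //; rewrite -ltnS prednK // ltnW.
by apply: maxidealMl; [apply: placeX | apply: maxidealX => //; apply: ltnW].
Qed.

(** The product of the y - b is y^q + y - a^(q+1) = x^(q+1) - a^(q+1), which lies in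
    the maximal ideal; the maximal ideal is prime. *)
Lemma value_y_exists (P : placeH) (a : K) (s : seq K) :
  'X^q + 'X - (a ^+ q.+1)%:P = \prod_(b <- s) ('X - b%:P) ->
  has_value P x a -> exists2 b, b \in s & has_value P y b.
Proof.
move=> fact Pa; have Py := place_ring_y (has_value_place Pa).
have : maxideal P (\prod_(b <- s) (y - iotaH b)).
  have -> : \prod_(b <- s) (y - iotaH b) = y ^+ q + y - iotaH (a ^+ q.+1).
    transitivity (map_poly iotaH ('X^q + 'X - (a ^+ q.+1)%:P)).[y].
      rewrite fact rmorph_prod horner_prod; apply: eq_bigr => b _.
      by rewrite rmorphB /= map_polyX map_polyC hornerXsubC.
    by rewrite rmorphB rmorphD /= map_polyXn map_polyX map_polyC !hornerE.
  by rewrite hermE; apply: (has_valueX q.+1 Pa).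
elim: s {fact} => [|b s IH]; first by rewrite big_nil => /maxideal1.
have PB c : place_ring P (y - iotaH c) by apply: placeB => //; apply: place_const.
rewrite big_cons => /maxideal_prime[]//.
- by elim/big_ind: _ => //; [apply: place1 | apply: placeM].
- by move=> mb; exists b; rewrite ?mem_head.
- by move=> /IH[c cs vc]; exists c; rewrite // inE cs orbT.
Qed.

End AffinePlaces.

(** * Solutions of the Hermitian equation over K *)
Section CountRoots.
Context (K : finFieldType) (q : nat) (hK : #|K| = (q ^ 2)%N).

Lemma hermitian_q_gt1 : (1 < q)%N.
Proof. by have := finNzRing_gt1 K; rewrite hK; case: q => [|[]]. Qed.

Lemma hermitian_q_pchar : (GRing.pchar K).-nat q.
Proof.
have [p p_pr pK] := finPcharP K.
have : p.-nat #|[set: K]| by exact: pprimeChar_pgroup pK.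
rewrite cardsT hK pnatX orbF.
by apply: sub_in_pnat => r _ /eqP ->.
Qed.

Lemma frobenius_sq (a : K) : a ^+ q ^+ q = a.
Proof. by rewrite -exprM mulnn -hK expf_card. Qed.

Lemma size_trinomial (c : K) : size ('X^q + 'X - c%:P) = q.+1.
Proof.
have q1 := hermitian_q_gt1.
by rewrite -addrA size_polyDl size_polyXn // size_XsubC ltnS.
Qed.

Lemma card_trace_fiber_le (c : K) : (#|[pred b : K | (b ^+ q + b == c)%R]| <= q)%N.
Proof.
have q1 := hermitian_q_gt1.
rewrite -ltnS -(size_trinomial c) cardE; apply: max_poly_roots.
- by rewrite -size_poly_eq0 size_trinomial.
- apply/allP => b; rewrite mem_enum inE => /eqP e.
  by rewrite rootE !hornerE e subrr.
- exact: enum_uniq.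
Qed.

Lemma card_fixed_le : (#|[pred c : K | (c ^+ q == c)%R]| <= q)%N.
Proof.
have q1 := hermitian_q_gt1.
have sz : size ('X^q - 'X : {poly K}) = q.+1.
  by rewrite size_polyDl size_polyXn // size_polyN size_polyX ltnS.
rewrite -ltnS -sz cardE; apply: max_poly_roots.
- by rewrite -size_poly_eq0 sz.
- apply/allP => b; rewrite mem_enum inE => /eqP e.
  by rewrite rootE !hornerE e subrr.
- exact: enum_uniq.
Qed.

(** The fibres of b -> b^q + b over the at most q fixed points of the q-th power
    cover the q^2 elements of K, and none has more than q elements: one deficient
    fibre would make the total smaller than q^2. *)
Lemma card_trace_fiber (c : K) : c ^+ q = c ->
  #|[pred b : K | (b ^+ q + b == c)%R]| = q.
Proof.
move=> cq; apply/eqP; rewrite eqn_leq card_trace_fiber_le leqNgt; apply/negP => lt.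
have : (#|K| < q ^ 2)%N; last by rewrite hK ltnn.
have -> : #|K| = \sum_(d : K | (d ^+ q == d)%R) #|[pred b : K | (b ^+ q + b == d)%R]|.
  rewrite -sum1_card (partition_big (fun b : K => b ^+ q + b) (fun d => d ^+ q == d)).
    by apply: eq_bigr => d _; rewrite -sum1_card; apply: eq_bigl => b; rewrite inE.
  move=> b _; rewrite exprDn_pchar ?frobenius_sq 1?addrC //.
  exact: hermitian_q_pchar.
have cS : c \in [pred c : K | (c ^+ q == c)%R] by rewrite inE cq.
rewrite (bigD1 c) ?cq //=.
apply: (@leq_trans (q + \sum_(d : K | ((d ^+ q == d) && (d != c))%R) q)).
  by rewrite -addSn leq_add // leq_sum // => d _; apply: card_trace_fiber_le.
rewrite sum_nat_const -mulSn -mulnn leq_mul // (leq_trans _ card_fixed_le) //.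
rewrite [leqRHS](cardD1 c) cS add1n ltnS; apply: eq_leq.
by apply: eq_card => d; rewrite !inE andbC.
Qed.

Definition affine_ordinates (a : K) : seq K :=
  enum [pred b : K | (b ^+ q + b == a ^+ q.+1)%R].

Lemma size_affine_ordinates (a : K) : size (affine_ordinates a) = q.
Proof.
rewrite -cardE card_trace_fiber // -exprM mulSn exprD exprM frobenius_sq.
by rewrite mulrC exprS.
Qed.

Lemma affine_ordinates_factor (a : K) :
  'X^q + 'X - (a ^+ q.+1)%:P = \prod_(b <- affine_ordinates a) ('X - b%:P).
Proof.
have q1 := hermitian_q_gt1.
set p := (p in p = _); have lp : lead_coef p = 1.
  rewrite /p -addrA lead_coefDl ?lead_coefXn //.
  by rewrite size_polyXn size_XsubC ltnS.
rewrite -[RHS]scale1r -lp; apply: all_roots_prod_XsubC.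
- by rewrite size_trinomial size_affine_ordinates.
- apply/allP => b; rewrite mem_enum inE => /eqP e.
  by rewrite rootE !hornerE e subrr.
- by rewrite uniq_rootsE enum_uniq.
Qed.
End CountRoots.

(** * Places of the rational function field and ramification *)
Section RationalPlaces.
Context (K : fieldType).
Implicit Types P : place (ratfun_const K).
Local Notation x := (ratfun_x K).

Lemma local_parameter_zero P (a : K) :
  has_value P x a -> local_parameter P (x - ratfun_const K a).
Proof.
move=> Pa; split=> // [|z z0].
  by rewrite /= -tofracB tofrac_eq0 polyXsubC_eq0.
have [k [c h]] := leading_ratfun_zero a z0; exists k, c.
exact: (h _ (ratfun_const K) idfun).
Qed.

Lemma place_zero_unique P P' (a : K) :
  has_value P x a -> has_value P' x a -> P = P'.
Proof.
move=> Pa P'a; have [p0 mp _] := local_parameter_zero Pa.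
apply: (leading_place_eq p0 mp P'a) => z z0.
have [k [c h]] := leading_ratfun_zero a z0; exists k, c.
by split; apply: (h _ (ratfun_const K) idfun).
Qed.

Lemma local_parameter_pole P : ~ place_ring P x -> local_parameter P x^-1.
Proof.
move=> nP; have mx := maxidealV nP.
have x0 : x^-1 != 0 by rewrite invr_eq0 tofrac_eq0 polyX_eq0.
split=> // z z0; have [k [c h]] := leading_ratfun_pole z0; exists (1%:Z * k), c.
have lx : leading P x^-1 x (- 1%:Z) 1.
  by have := leadingV x0 (leading_self P x0); rewrite invrK invr1.
exact: (h _ (ratfun_const K) idfun (fun=> erefl) P _ _ x0 mx (ltn0Sn 0) lx).
Qed.

End RationalPlaces.

Section Ramification.
Context (K F : fieldType) (iota : {rmorphism K -> F}) (L : fieldExtType F).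

(** The places of the rational function field are obtained as traces of the places of
    the Hermitian field, so no separate construction of them is needed. *)
Lemma restriction_place (P' : place (ext_const iota L)) (t : F) : t != 0 ->
  maxideal P' (in_alg L t) -> exists2 P : place iota, lies_above P' P &
    forall z c, has_value P z c <-> has_value P' (in_alg L z) c.
Proof.
move=> t0 mt; have hj c : in_alg L (iota c) = ext_const iota L c by [].
have [P PE] := pullback_place hj t0 mt.
exists P => [z /(pullback_maxideal PE)//|z c].
exact: (pullback_value hj PE).
Qed.

Context (P : place iota) (P' : place (ext_const iota L)).

Lemma lies_above_value z c : lies_above P' P -> has_value P z c ->
  has_value P' (in_alg L z) c.
Proof. by move=> above /above; rewrite /has_value -in_algE rmorphB. Qed.

(** The order of t at P' multiplies all orders: if z = t^n u with u of nonzero residue,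
    then u keeps its residue at P'. *)
Lemma ramification_indexE (t : F) (p : L) (e : nat) (c : K) :
  (0 < e)%N -> lies_above P' P -> local_parameter P t -> uniformizer P' p ->
  leading P' p (in_alg L t) e c -> ramification_index P' P = e.
Proof.
move=> e0 above tP pP' lt; have [t0 _ lead] := tP.
have p0 := uniformizer_neq0 pP'; have ut := local_parameter_uniformizer tP.
have val z : z != 0 -> valuation P' (in_alg L z) = e%:Z * valuation P z.
  move=> /lead[n [d ld]]; rewrite (valuation_leading ut ld).
  have [d0 vd] := ld; have lu := leading_value p d0 (lies_above_value above vd).
  have lX := leadingXz n p0 lt.
  have := leadingM p0 lu lX; rewrite add0r -fmorphXz -rmorphM.
  rewrite -mulrA -expfzDr // addNr expr0z mulr1 => l.
  exact: valuation_leading pP' l.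
apply: xget_unique; first by split.
move=> e' [e'0 val']; have := val' t t0.
rewrite -in_algE val // (valuation_leading ut (leading_self P t0)) !mulr1.
by case.
Qed.

End Ramification.

(** * Splitting of the zeros of x - a and ramification at infinity *)
Section Final.
Context (q : nat) (K : finFieldType) (hK : #|K| = (q ^ 2)%N).
Context (H : fieldExtType (ratfun K)) (y : H) (hH : hermitian_field q y).
Local Notation iotaH := (ext_const (ratfun_const K) H).
Local Notation placeH := (place iotaH).
Local Notation placeF := (place (ratfun_const K)).
Local Notation x := (herm_x H).
Context (Q : placeH) (nQ : ~ place_ring Q x).
Let q1 := hermitian_q_gt1 hK.
Let pq := hermitian_q_pchar hK.
Let Kq := frobenius_sq hK.

Lemma place_zero_exists (a : K) : exists P : placeF, has_value P (ratfun_x K) a.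
Proof.
have [b] : exists b, b \in affine_ordinates q a.
  case E : (affine_ordinates q a) (size_affine_ordinates hK a) => [|b s] /=.
    by move=> q0; move: q1; rewrite -q0.
  by exists b; rewrite mem_head.
rewrite mem_enum inE => /eqP ab.
have [P' [P'a _]] := affine_place_exists q1 pq Kq hH ab nQ.
have t0 : ratfun_x K - ratfun_const K a != 0.
  by rewrite /= -tofracB tofrac_eq0 polyXsubC_eq0.
have mt : maxideal P' (in_alg H (ratfun_x K - ratfun_const K a)).
  by rewrite in_alg_ratfun_x_const; exact: P'a.
by have [P _ PE] := restriction_place t0 mt; exists P; apply/PE.
Qed.

(** A place with x = a lies above its own trace on K(x), which is P by uniqueness. *)
Lemma lies_above_zero (P : placeF) (P' : placeH) (a : K) :
  has_value P (ratfun_x K) a -> (lies_above P' P <-> has_value P' x a).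
Proof.
move=> Pa; split=> [above|P'a].
  by rewrite -in_alg_ratfun_x; apply: lies_above_value above Pa.
have [t0 _ _] := local_parameter_zero Pa.
have mt : maxideal P' (in_alg H (ratfun_x K - ratfun_const K a)).
  by rewrite in_alg_ratfun_x_const; exact: P'a.
have [P1 above PE] := restriction_place t0 mt.
suff -> : P = P1 by [].
by apply: place_zero_unique Pa _; apply/PE.
Qed.

Lemma places_above_zero (P : placeF) (a : K) : has_value P (ratfun_x K) a ->
  num_places_above H P = q.
Proof.
move=> Pa.
have plP b : exists P' : placeH, b \in affine_ordinates q a ->
    has_value P' x a /\ has_value P' y b.
  have [ab|nb] := boolP (b \in affine_ordinates q a); last by exists Q.
  move: ab; rewrite mem_enum inE => /eqP ab.
  by have [P' ?] := affine_place_exists q1 pq Kq hH ab nQ; exists P'.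
(* [plP] holds vacuously outside the solutions b, where Q is a default value. *)
have [pl plE] := choice plP.
pose s := [seq pl b | b <- affine_ordinates q a].
have us : uniq s.
  rewrite map_inj_in_uniq ?enum_uniq // => b b' bs b's e.
  have [_ vb] := plE b bs; have [_ vb'] := plE b' b's.
  by apply: has_value_uniq vb _; rewrite e.
rewrite /num_places_above.
have -> : places_above P = [set` [fset P' in s]%fset]%classic.
  apply/seteqP; split=> P' /=; rewrite !inE => h.
    have P'a : has_value P' x a by apply/(lies_above_zero P' Pa).
    have [b bs P'b] := value_y_exists q1 hH (affine_ordinates_factor hK a) P'a.
    apply/mapP; exists b => //; have [pa pb] := plE b bs.
    move: bs; rewrite mem_enum inE => /eqP ab.
    exact: (affine_place_unique q1 pq Kq hH ab nQ).
  have [b bs ->] := mapP h; apply/(lies_above_zero _ Pa).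
  by have [] := plE b bs.
by rewrite set_fsetK card_fseq undup_id // size_map size_affine_ordinates.
Qed.

Lemma ramification_zero (P : placeF) (P' : placeH) (a : K) :
  has_value P (ratfun_x K) a -> lies_above P' P -> ramification_index P' P = 1%N.
Proof.
move=> Pa above; have P'a : has_value P' x a by apply/(lies_above_zero P' Pa).
have [b + P'b] := value_y_exists q1 hH (affine_ordinates_factor hK a) P'a.
rewrite mem_enum inE => /eqP ab.
have lp := affine_local_parameter q1 pq Kq hH ab nQ P'a P'b.
have [t0 _ _] := lp.
apply: (ramification_indexE _ above (local_parameter_zero Pa)
          (local_parameter_uniformizer lp) (c := 1)) => //.
by rewrite in_alg_ratfun_x_const; apply: leading_self.
Qed.

Lemma infinite_place_exists : exists P : placeF,
  [/\ ~ place_ring P (ratfun_x K), places_above P = [set Q]%classic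
    & ramification_index Q P = q].
Proof.
have x0 : (ratfun_x K)^-1 != 0 by rewrite invr_eq0 tofrac_eq0 polyX_eq0.
have mx : maxideal Q (in_alg H (ratfun_x K)^-1).
  by rewrite in_algV in_alg_ratfun_x; apply: maxidealV.
have [P above PE] := restriction_place x0 mx.
have nP : ~ place_ring P (ratfun_x K).
  by rewrite -[ratfun_x K]invrK; apply/maxidealVN/has_value0/PE/has_value0.
exists P; split=> //.
  apply/seteqP; split=> [P' above'|_ ->] //=.
  apply: (place_inf_unique q1 hH) nQ => Px.
  have := above' _ (maxidealV nP); rewrite -in_algE in_algV in_alg_ratfun_x.
  move=> /maxidealVN; rewrite invrK; apply=> //.
  by rewrite -in_alg_ratfun_x -in_algV fmorph_eq0.
have [p0 _ lx _] := herm_leading_inf q1 hH nQ.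
apply: (ramification_indexE (ltnW q1) above (local_parameter_pole nP)
  (local_parameter_uniformizer (local_parameter_inf q1 hH nQ)) (c := 1)).
by rewrite in_algV in_alg_ratfun_x; have := leadingV p0 lx; rewrite opprK invr1.
Qed.

End Final.

Theorem proposition6p4 (q : nat) (K : finFieldType) (hK : #|K| = (q ^ 2)%N)
    (H : fieldExtType (ratfun K)) (y : H) (hH : hermitian_field q y)
    (Qinf : place (ext_const (ratfun_const K) H)) (hQ : common_pole y Qinf)
    (n : nat) (D' : n.-tuple (place (ext_const (ratfun_const K) H)))
    (hD' : hermitian_support q y D')
    (a : int) (ha : (q%:Z %| a)%Z) :
  exists (m : nat) (D : m.-tuple (place (ratfun_const K)))
         (G : divisor (ratfun_const K)),
    ag_data D G /\ is_conorm_code D G D' (ag_code D' << a *g Qinf >>).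
Proof.
have nQ := pole_not_integral hQ.1.
have [pl plE] := choice (place_zero_exists hK hH nQ).
have [Pinf [nPinf aboveinf raminf]] := infinite_place_exists hK hH nQ.
have [b aE] : exists b, a = b * q%:Z by case/dvdzP: ha => b ->; exists b.
exists #|K|, (map_tuple pl (enum_tuple K)), << b *g Pinf >>.
have memD P : reflect (exists c, P = pl c) (P \in map_tuple pl (enum_tuple K)).
  apply: (iffP mapP) => [[c _ ->]|[c ->]]; exists c => //.
  by rewrite mem_enum.
split.
  split.
  - rewrite map_inj_uniq ?enum_uniq // => c d e.
    by apply: has_value_uniq (plE c) _; rewrite e.
  - by move=> _ /memD[c ->]; apply/local_parameter_rational/local_parameter_zero/plE.
  - move=> _ /memD[c ->]; rewrite coeffU; have [e|] := eqVneq Pinf (pl c); last first.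
      by rewrite mulr0.
    by case: nPinf; rewrite e; apply: has_value_place (plE c).
have [uD' D'E] := hD'.
split=> //.
- move=> _ P' /memD[c ->] above.
  rewrite (ramification_zero hK hH nQ (plE c) above).
  rewrite (dim_herm (hermitian_q_gt1 hK) hH nQ) (places_above_zero hK hH nQ (plE c)).
  by rewrite divff // pnatr_eq0 -lt0n ltnW // (hermitian_q_gt1 hK).
- move=> P'; rewrite D'E; split.
    move=> [c [d [_ [_ P'c _]]]]; exists (pl c); first by apply/memD; exists c.
    exact/(lies_above_zero P' (plE c)).
  move=> [_ /memD[c ->] /(lies_above_zero P' (plE c)) P'c].
  have q1 := hermitian_q_gt1 hK.
  have [d + P'd] := value_y_exists q1 hH (affine_ordinates_factor hK c) P'c.
  rewrite mem_enum inE => /eqP cd; exists c, d; split=> //; split=> //.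
  apply: local_parameter_rational.
  exact: (affine_local_parameter q1 (hermitian_q_pchar hK) (frobenius_sq hK) hH
            cd nQ P'c P'd).
- congr (ag_code _ _); rewrite /conorm liftU aboveinf fsbig_set1 raminf.
  by apply/eqP/freeg_eqP => P; rewrite coeffZ !coeffU aE mulrA.
Qed.
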